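(* Let $r\ge2$ and suppose Assumption C (stated in the context) holds for the constrained distributed optimization problem $$\min\ f(\bm x):=\sum_{i=1}^n f_i(x_i)\quad\text{s.t.}\quad \bm L\bm x=0,\ \bm x\in\Omega. \qquad (P)$$ Let $(\bm x(t),\bm u(t),\bm y(t),\bm v(t))$ be a trajectory of the dynamics (D1) of the context, and let $(\bm x^\star,\bm u^\star,\bm y^\star,\bm v^\star)$ be an equilibrium point of (D1), where $(\bm x^\star,\bm y^\star)$ is a saddle point of $S_1$ over $\Omega\times\mathbb R^{pn}$ and $\bm x^\star$ is the optimal solution to (P). Then: (i) the duality gap $S_1(\bm x(t),\bm y^\star)-S_1(\bm x^\star,\bm y(t))$ converges to $0$ with a rate of $\mathcal O(1/t^2)$; (ii) $\bm x(t)$ converges to $\bm x^\star$ as $t\to\infty$; (iii) both $\Vert\bm L\bm x(t)\Vert$ and $|f(\bm x(t))-f(\bm x^\star)|$ converge to $0$ with a rate of $\mathcal O(1/t)$.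
   Context: $\mathcal G$ is an undirected connected graph on $\mathcal V=\{1,\dots,n\}$ with symmetric adjacency matrix $\mathcal A=[a_{ij}]$, where $a_{ij}=a_{ji}>0$ if $(i,j)$ is an edge and $a_{ij}=0$ otherwise; its Laplacian is $\mathcal L=\mathcal D-\mathcal A$, $\mathcal D={\rm diag}\{d_i\}$, $d_i=\sum_j a_{ij}$. Set $\bm L=\mathcal L\otimes I_p\in\mathbb R^{pn\times pn}$, $\Omega=\Omega_1\times\dots\times\Omega_n$ with $\Omega_i\subset\mathbb R^p$, and $\bm x=[x_1^{\rm T},\dots,x_n^{\rm T}]^{\rm T}\in\mathbb R^{pn}$ (similarly $\bm y,\bm u,\bm v\in\mathbb R^{pn}$). Assumption C: for each $i\in\mathcal V$, $\Omega_i$ is closed and convex, $f_i$ is continuously differentiable and strictly convex on an open set containing $\Omega_i$, and $\nabla f_i$ is Lipschitz continuous over $\Omega_i$. Slater's condition holds for (P) (there is $\bm x$ in the relative interior of $\Omega$ with $\bm L\bm x=0$), and (P) has a unique solution. $S_1(\bm x,\bm y):=f(\bm x)+\bm y^{\rm T}\bm L\bm x+\frac12\bm x^{\rm T}\bm L\bm x$ for $\bm x\in\Omega$, $\bm y\in\mathbb R^{pn}$; $(\bm x^\star,\bm y^\star)\in\Omega\times\mathbb R^{pn}$ is a saddle point of $S_1$ if $S_1(\bm x^\star,\bm y)\le S_1(\bm x^\star,\bm y^\star)\le S_1(\bm x,\bm y^\star)$ for all $\bm x\in\Omega,\bm y\in\mathbb R^{pn}$. $P_{\Omega_i}$ denotes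 Euclidean projection onto $\Omega_i$. Dynamics (D1), for $i\in\mathcal V$: $$\dot x_i=\tfrac rt[P_{\Omega_i}(u_i)-x_i],\qquad \dot y_i=\tfrac rt[v_i-y_i],$$ $$\dot u_i=\tfrac tr\big[-\nabla_{x_i}S_1(\bm x,\bm y+\tfrac tr\dot{\bm y})+x_i+\tfrac tr\dot x_i-u_i\big],$$ $$\dot v_i=\tfrac tr\big[\nabla_{y_i}S_1(\bm x+\tfrac tr\dot{\bm x},\bm y)+y_i+\tfrac tr\dot y_i-v_i\big],$$ with $x_i(0)=u_i(0)=u_{i,0}\in\Omega_i$ and $y_i(0)=v_i(0)=v_{i,0}\in\mathbb R^p$. A trajectory is a tuple of functions continuous on $[0,\infty)$ and differentiable on $(0,\infty)$, satisfying the differential equations for $t>0$ and the initial conditions at $t=0$. An equilibrium point is a constant tuple at which all brackets vanish with $\dot{\bm x}=0,\dot{\bm y}=0$. A nonnegative quantity $g(t)$ converges to $0$ with rate $\mathcal O(1/t^k)$ if there is a constant $C$ (independent of $t$) with $g(t)\le C/t^k$ for all sufficiently large $t$. *)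

(* Defs.v *)
From HB Require Import structures.
From mathcomp Require Import all_boot all_order all_algebra.
From mathcomp Require Import all_classical all_reals all_analysis.
From mathcomp Require Import mxtens.

Set Implicit Arguments.
Unset Strict Implicit.
Unset Printing Implicit Defensive.

Import Order.TTheory GRing.Theory Num.Theory.
Import numFieldNormedType.Exports.

Local Open Scope classical_set_scope.
Local Open Scope ring_scope.

(* The library norm on matrices is the sup norm, hence this definition. *)
Definition enorm (R : realType) (m : nat) (z : 'cV[R]_m) : R :=
  Num.sqrt (\sum_(k < m) z k 0 ^+ 2).

Definition grad (R : realType) (m : nat) (g : 'cV[R]_m -> R) (z : 'cV[R]_m) :
    'cV[R]_m :=
  \col_(k < m) 'D_(delta_mx k 0 : 'cV[R]_m) g z.

Definition is_projection (R : realType) (m : nat) (A : set 'cV[R]_m)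
    (u z : 'cV[R]_m) : Prop :=
  A z /\ forall w, A w -> enorm (u - z) <= enorm (u - w).

(* Defaults to 0 when u has no nearest point in A; for A nonempty, closed and
   convex the nearest point exists and is unique. *)
Definition proj (R : realType) (m : nat) (A : set 'cV[R]_m) (u : 'cV[R]_m) :
    'cV[R]_m :=
  xget 0 [set z | is_projection A u z].

Definition affine_hull (R : realType) (m : nat) (A : set 'cV[R]_m) :
    set 'cV[R]_m :=
  [set z | exists (k : nat) (c : 'I_k -> R) (w : 'I_k -> 'cV[R]_m),
     [/\ forall j, A (w j), \sum_j c j = 1 & z = \sum_j c j *: w j]].

Definition relative_interior (R : realType) (m : nat) (A : set 'cV[R]_m) :
    set 'cV[R]_m :=
  [set z | A z /\ \forall w \near z, affine_hull A w -> A w].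

Definition C1_on (R : realType) (m : nat) (U : set 'cV[R]_m)
    (g : 'cV[R]_m -> R) : Prop :=
  forall z, U z -> differentiable g z /\ {for z, continuous (grad g)}.

(* U is not required to be convex: the inequality is imposed on the segments
   contained in U, i.e. on all segments with endpoints in U if U is convex. *)
Definition strictly_convex_on (R : realType) (m : nat) (U : set 'cV[R]_m)
    (g : 'cV[R]_m -> R) : Prop :=
  forall z w, U z -> U w -> z != w ->
    (forall s : R, 0 <= s <= 1 -> U (s *: z + (1 - s) *: w)) ->
    forall s : R, 0 < s < 1 ->
      g (s *: z + (1 - s) *: w) < s * g z + (1 - s) * g w.

Definition lipschitz_over (R : realType) (m : nat) (A : set 'cV[R]_m)
    (h : 'cV[R]_m -> 'cV[R]_m) : Prop :=
  exists K : R, forall z w, A z -> A w -> enorm (h z - h w) <= K * enorm (z - w).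

Definition connected_weighted_graph (R : realType) (n : nat) (e : rel 'I_n)
    (a : 'M[R]_n) : Prop :=
  [/\ symmetric e,
      forall i j : 'I_n, connect e i j,
      forall i j, a i j = a j i
    & forall i j, (e i j -> 0 < a i j) /\ (~~ e i j -> a i j = 0)].

Definition laplacian (R : realType) (n : nat) (a : 'M[R]_n) : 'M[R]_n :=
  diag_mx (\row_i \sum_j a i j) - a.

Definition bigL (R : realType) (n p : nat) (a : 'M[R]_n) : 'M[R]_(n * p) :=
  laplacian a *t (1%:M : 'M[R]_p).

(* The i-th component x_i in R^p of the stacked vector x = [x_1; ...; x_n]. *)
Definition block (R : realType) (n p : nat) (i : 'I_n) (z : 'cV[R]_(n * p)) :
    'cV[R]_p :=
  \col_(k < p) z (mxtens_index (i, k)) 0.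

Definition prod_set (R : realType) (n p : nat) (Omega : 'I_n -> set 'cV[R]_p) :
    set 'cV[R]_(n * p) :=
  [set z | forall i, Omega i (block i z)].

Definition total_cost (R : realType) (n p : nat) (f : 'I_n -> 'cV[R]_p -> R)
    (x : 'cV[R]_(n * p)) : R :=
  \sum_(i < n) f i (block i x).

Definition feasible (R : realType) (n p : nat) (a : 'M[R]_n)
    (Omega : 'I_n -> set 'cV[R]_p) : set 'cV[R]_(n * p) :=
  [set x | bigL p a *m x = 0 /\ prod_set Omega x].

Definition is_solution (R : realType) (n p : nat) (a : 'M[R]_n)
    (f : 'I_n -> 'cV[R]_p -> R) (Omega : 'I_n -> set 'cV[R]_p)
    (x : 'cV[R]_(n * p)) : Prop :=
  feasible a Omega x /\
  forall z, feasible a Omega z -> total_cost f x <= total_cost f z.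

Definition assumption_C (R : realType) (n p : nat) (a : 'M[R]_n)
    (f : 'I_n -> 'cV[R]_p -> R) (Omega : 'I_n -> set 'cV[R]_p) : Prop :=
  [/\ forall i, closed (Omega i) /\ convex_set (Omega i),
      forall i, exists U : set 'cV[R]_p,
        [/\ open U, Omega i `<=` U, C1_on U (f i) & strictly_convex_on U (f i)],
      forall i, lipschitz_over (Omega i) (grad (f i)),
      exists x, relative_interior (prod_set Omega) x /\ bigL p a *m x = 0
    & exists! x, is_solution a f Omega x].

Definition S1 (R : realType) (n p : nat) (a : 'M[R]_n)
    (f : 'I_n -> 'cV[R]_p -> R) (x y : 'cV[R]_(n * p)) : R :=
  total_cost f x + (y^T *m bigL p a *m x) 0 0
  + 2^-1 * (x^T *m bigL p a *m x) 0 0.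

Definition saddle_point (R : realType) (n p : nat) (a : 'M[R]_n)
    (f : 'I_n -> 'cV[R]_p -> R) (Omega : 'I_n -> set 'cV[R]_p)
    (xs ys : 'cV[R]_(n * p)) : Prop :=
  prod_set Omega xs /\
  forall x y, prod_set Omega x ->
    S1 a f xs y <= S1 a f xs ys /\ S1 a f xs ys <= S1 a f x ys.

(* The brackets in the right-hand sides; dx and dy stand for (t/r) x' and
   (t/r) y'. *)
Definition bracket_x (R : realType) (n p : nat) (Omega : 'I_n -> set 'cV[R]_p)
    (x u : 'cV[R]_(n * p)) (i : 'I_n) : 'cV[R]_p :=
  proj (Omega i) (block i u) - block i x.

Definition bracket_y (R : realType) (n p : nat) (y v : 'cV[R]_(n * p))
    (i : 'I_n) : 'cV[R]_p :=
  block i v - block i y.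

Definition bracket_u (R : realType) (n p : nat) (a : 'M[R]_n)
    (f : 'I_n -> 'cV[R]_p -> R) (x u y dx dy : 'cV[R]_(n * p)) (i : 'I_n) :
    'cV[R]_p :=
  - block i (grad (fun z => S1 a f z (y + dy)) x)
  + block i x + block i dx - block i u.

Definition bracket_v (R : realType) (n p : nat) (a : 'M[R]_n)
    (f : 'I_n -> 'cV[R]_p -> R) (x y v dx dy : 'cV[R]_(n * p)) (i : 'I_n) :
    'cV[R]_p :=
  block i (grad (fun z => S1 a f (x + dx) z) y)
  + block i y + block i dy - block i v.

Definition equilibrium (R : realType) (n p : nat) (a : 'M[R]_n)
    (f : 'I_n -> 'cV[R]_p -> R) (Omega : 'I_n -> set 'cV[R]_p)
    (xs us ys vs : 'cV[R]_(n * p)) : Prop :=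
  forall i,
    [/\ bracket_x Omega xs us i = 0,
        bracket_y ys vs i = 0,
        bracket_u a f xs us ys 0 0 i = 0
      & bracket_v a f xs ys vs 0 0 i = 0].

Definition continuous_differentiable_path (R : realType) (m : nat)
    (z : R -> 'cV[R]_m) : Prop :=
  {within `[0%R, +oo[%classic, continuous z} /\
  forall t : R, 0 < t -> derivable z t 1.

(* Only the values at times t >= 0 of the functions x, u, y, v matter. *)
Definition trajectory (R : realType) (n p : nat) (r : R) (a : 'M[R]_n)
    (f : 'I_n -> 'cV[R]_p -> R) (Omega : 'I_n -> set 'cV[R]_p)
    (u0 v0 : 'cV[R]_(n * p)) (x u y v : R -> 'cV[R]_(n * p)) : Prop :=
  [/\ [/\ continuous_differentiable_path x, continuous_differentiable_path u,
          continuous_differentiable_path y & continuous_differentiable_path v],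
      [/\ prod_set Omega u0, x 0 = u0, u 0 = u0, y 0 = v0 & v 0 = v0]
    & forall t : R, 0 < t -> forall i : 'I_n,
        let dx := (t / r) *: derive1 x t in
        let dy := (t / r) *: derive1 y t in
        [/\ block i (derive1 x t) = (r / t) *: bracket_x Omega (x t) (u t) i,
            block i (derive1 y t) = (r / t) *: bracket_y (y t) (v t) i,
            block i (derive1 u t) =
              (t / r) *: bracket_u a f (x t) (u t) (y t) dx dy i
          & block i (derive1 v t) =
              (t / r) *: bracket_v a f (x t) (y t) (v t) dx dy i]].

Definition vanishes_with_rate (R : realType) (k : nat) (g : R -> R) : Prop :=
  (forall t : R, 0 <= t -> 0 <= g t) /\
  exists C : R, \forall t \near +oo, g t <= C / t ^+ k.

(* Main.v *)
Require Import Defs.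
From HB Require Import structures.
From mathcomp Require Import all_boot all_order all_algebra.
From mathcomp Require Import all_classical all_reals all_analysis.
From mathcomp Require Import mxtens.
From mathcomp Require Import ring lra.

Set Implicit Arguments.
Unset Strict Implicit.
Unset Printing Implicit Defensive.

Import Order.TTheory GRing.Theory Num.Theory.
Import numFieldNormedType.Exports.

Local Open Scope classical_set_scope.
Local Open Scope ring_scope.

(* With w the projection of u, the dynamics give x + (t/r) x' = w and
   y + (t/r) y' = v, and
     (t/r)^2 (S1(x, ys) - S1(xs, y))
       + (|u - xs|^2 - |u - w|^2) / 2 + |v - ys|^2 / 2
   is nonincreasing: the cross terms of u' and v' cancel against the derivative
   of the gap, and what remains is at most (t/r)(2/r - 1) times the gap. This is
   (i). The gap is the sum of the gap of the non-augmented Lagrangian, which is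
   nonnegative, and of x^T L x / 2; as L is positive semidefinite,
   |L x|^2 <= M x^T L x, hence (iii). The non-augmented gap is strictly convex
   and vanishes only at xs, hence (ii). *)

(** * Euclidean inner product of column vectors *)

Section Dot.
Context {R : realType} {m : nat}.
Implicit Types (x y z : 'cV[R]_m).

Definition dot x y : R := \sum_k x k 0 * y k 0.

Lemma dotC x y : dot x y = dot y x.
Proof. by apply: eq_bigr => k _; rewrite mulrC. Qed.

Lemma dotDr x y z : dot x (y + z) = dot x y + dot x z.
Proof. by rewrite -big_split; apply: eq_bigr => k _; rewrite mxE mulrDr. Qed.

Lemma dotZr (c : R) x y : dot x (c *: y) = c * dot x y.
Proof. by rewrite mulr_sumr; apply: eq_bigr => k _; rewrite mxE mulrCA. Qed.

Lemma dotNr x y : dot x (- y) = - dot x y.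
Proof. by rewrite -scaleN1r dotZr mulN1r. Qed.

Lemma dotDl x y z : dot (y + z) x = dot y x + dot z x.
Proof. by rewrite dotC dotDr !(dotC x). Qed.

Lemma dotZl (c : R) x y : dot (c *: y) x = c * dot y x.
Proof. by rewrite dotC dotZr dotC. Qed.

Lemma dotNl x y : dot (- y) x = - dot y x.
Proof. by rewrite dotC dotNr dotC. Qed.

Lemma dot0r x : dot x 0 = 0.
Proof. by rewrite -(scale0r 0) dotZr mul0r. Qed.

Definition dotE := (dotDl, dotDr, dotNl, dotNr, dotZl, dotZr).

Lemma dot_ge0 x : 0 <= dot x x.
Proof. by apply: sumr_ge0 => k _; rewrite -expr2 sqr_ge0. Qed.

Lemma dot_gt0 x : x != 0 -> 0 < dot x x.
Proof.
move=> x0; rewrite lt_neqAle dot_ge0 andbT eq_sym; apply: contra x0 => /eqP d0.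
apply/eqP/matrixP => k j; rewrite ord1 mxE; apply/eqP.
rewrite -sqrf_eq0 expr2; apply/eqP.
by move/psumr_eq0P : d0 => ->// i _; rewrite -expr2 sqr_ge0.
Qed.

Lemma sqr_le_dot x k : x k 0 ^+ 2 <= dot x x.
Proof.
rewrite /dot (bigD1 k)//= -expr2 lerDl.
by apply: sumr_ge0 => i _; rewrite -expr2 sqr_ge0.
Qed.

Lemma enormE x : enorm x = Num.sqrt (dot x x).
Proof. by congr Num.sqrt; apply: eq_bigr => k _; rewrite expr2. Qed.

Lemma enorm_le x y : (enorm x <= enorm y) = (dot x x <= dot y y).
Proof. by rewrite !enormE ler_sqrt// dot_ge0. Qed.

Lemma dot_mulmx x y : (x^T *m y) 0 0 = dot x y.
Proof. by rewrite mxE; apply: eq_bigr => k _; rewrite mxE. Qed.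

Lemma continuous_dot : continuous (fun x => dot x x).
Proof.
rewrite /dot; apply: continuous_big => [|k _]; first exact: add_continuous.
by move=> x; apply: continuousM; exact: coord_continuous.
Qed.

(** The domain [V] is left general: it is the time axis along a trajectory, and the space of vectors
    itself when [S1] is differentiated in a direction. *)
Lemma is_derive_dot (V : normedModType R) (X Y : V -> 'cV[R]_m) (t v : V) dX dY :
  is_derive t v X dX -> is_derive t v Y dY ->
  is_derive t v (fun s => dot (X s) (Y s)) (dot dX (Y t) + dot (X t) dY).
Proof.
move=> [Xt <-] [Yt <-].
have coord (Z : V -> 'cV[R]_m) k : derivable Z t v ->
    is_derive t v (fun s => Z s k 0) ('D_v Z t k 0).
  move=> Zt; rewrite derive_mx// mxE; apply: derivableP.
  by move/derivable_mxP : Zt.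
rewrite (_ : (fun s => _) =
    \sum_(k < m) ((fun s => X s k 0) * (fun s => Y s k 0))); last first.
  by apply/funext => s; rewrite fct_sumE.
rewrite -big_split/=.
apply: is_derive_sum => k.
have H := is_deriveM (coord X k Xt) (coord Y k Yt).
apply: (is_derive_eq H); rewrite addrC; congr (_ + _); exact: mulrC.
Qed.

End Dot.

Lemma dot_trmx_mul (R : realType) (m k : nat) (B : 'M[R]_(m, k)) x y :
  dot x (B *m y) = dot (B^T *m x) y.
Proof. by rewrite -!dot_mulmx trmx_mul trmxK mulmxA. Qed.

(** * Convex sets, compactness and projection onto a closed set *)

Lemma convex_set_segment (R : realType) (m : nat) (A : set 'cV[R]_m) :
  convex_set A -> forall z w (s : R), A z -> A w -> 0 <= s <= 1 ->
  A (s *: z + (1 - s) *: w).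
Proof.
move=> cA z w s Az Aw s01.
have := cA z w (Itv01 (andP s01).1 (andP s01).2).
by rewrite !inE; apply.
Qed.

Lemma norm_trmx (R : realType) (m k : nat) (B : 'M[R]_(m, k)) : `|B^T| = `|B|.
Proof.
suff le j l (C : 'M[R]_(j, l)) : `|C^T| <= `|C|.
  by apply/eqP; rewrite eq_le le -{1}(trmxK B) le.
rewrite [`|C^T|]mx_normrE bigmax_le// => -[i1 i2] _ /=.
by rewrite mxE [leRHS]mx_normrE (le_bigmax _ (fun i => `|C i.1 i.2|) (i2, i1)).
Qed.

Lemma continuous_trmx (R : realType) (m k : nat) :
  continuous (@trmx R m k).
Proof.
move=> B; apply/(@cvgrPdist_lt _ _ _ _ (nbhs_filter B)) => /= eps eps0; near=> C.
rewrite -raddfB norm_trmx.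
by near: C; exact: cvgr_dist_lt.
Unshelve. all: by end_near. Qed.

(** The statement for row vectors is carried over by transposition, a continuous isometry. *)
Lemma cV_bounded_closed_compact (R : realType) (m : nat) (A : set 'cV[R]_m) :
  bounded_set A -> closed A -> compact A.
Proof.
move=> bA cA.
have -> : A = @trmx R 1 m @` (@trmx R 1 m @^-1` A).
  apply/seteqP; split => [z Az|_ [z Az <-]//].
  by exists z^T; rewrite /= ?trmxK.
apply: continuous_compact.
  by apply: continuous_subspaceT => z; exact: continuous_trmx.
apply: bounded_closed_compact.
  case: bA => M [Mreal bM]; exists M; split=> // N MN z /(bM _ MN).
  by rewrite /= norm_trmx.
by apply: preimage_closed => // z _; exact: continuous_trmx.
Qed.

Lemma norm_le_enorm (R : realType) (m : nat) (z : 'cV[R]_m) : `|z| <= enorm z.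
Proof.
rewrite [leLHS]mx_normrE bigmax_le ?sqrtr_ge0// => -[i j] _ /=.
by rewrite ord1 -sqrtr_sqr enormE ler_sqrt ?dot_ge0// sqr_le_dot.
Qed.

Lemma continuous_subr (R : realType) (m : nat) (u : 'cV[R]_m) :
  continuous (fun z : 'cV[R]_m => u - z).
Proof.
move=> z; apply: (@continuousB _ _ _ (cst u) id); first exact: cst_continuous.
exact: id.
Qed.

(** The part [K] of [A] no further from [u] than a chosen point [a] is compact, so the squared
    distance has a minimiser there. Points of [A] outside [K] are further away than [a]. *)
Lemma ex_projection (R : realType) (m : nat) (A : set 'cV[R]_m) (u : 'cV[R]_m) :
  closed A -> A !=set0 -> exists w, is_projection A u w.
Proof.
move=> cA [a Aa].
pose d z := dot (u - z) (u - z).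
have dc : continuous d.
  move=> z; rewrite [d](_ : _ = (fun z => dot z z) \o (fun z => u - z))//.
  by apply: continuous_comp; [exact: continuous_subr|exact: continuous_dot].
pose K := A `&` d @^-1` [set c | c <= d a].
have cK : compact K.
  apply: cV_bounded_closed_compact.
    exists (`|u| + enorm (u - a)); split; first exact: num_real.
    move=> M ltM z [_ /= dza]; apply: le_trans (ltW ltM).
    rewrite -[z](subKr u) (le_trans (ler_normB _ _))// lerD2l.
    by rewrite (le_trans (norm_le_enorm _))// enorm_le.
  apply: closedI => //; apply: preimage_closed; last exact: closed_le.
  by move=> z _; exact: dc.
have K0 : K !=set0 by exists a; split => //=.
have [w] := compact_EVT_min K0 cK (continuous_subspaceT dc).
rewrite inE => -[Aw dwa] minw; exists w; split => // z Az.
rewrite enorm_le -/(d w) -/(d z); have [dz|/ltW dz] := leP (d z) (d a).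
  by apply: minw; rewrite inE.
exact: le_trans dz.
Qed.

(** Existence of a nearest point rules out the default value 0 of [proj]. *)
Lemma is_projection_proj (R : realType) (m : nat) (A : set 'cV[R]_m)
    (u : 'cV[R]_m) :
  closed A -> A !=set0 -> is_projection A u (Defs.proj A u).
Proof.
move=> cA A0; have [w wP] := ex_projection u cA A0.
exact: (@xgetPex _ _ [set z | is_projection A u z] (ex_intro _ w wP)).
Qed.

(** Stands for the limit s -> 0. If a > 0, the choice s = a / (a + b) contradicts the bound when b >
    0, and s = 1/2 does when b <= 0. *)
Lemma le0_of_le_scaled (R : realFieldType) (a b : R) :
  (forall s, 0 < s < 1 -> a <= s * b) -> a <= 0.
Proof.
move=> ab; rewrite leNgt; apply/negP => a0.
have [b0|b0] := leP b 0.
  by have := ab 2^-1; rewrite invf_lt1// invr_gt0 !ltr0n ltr1n/= => /(_ isT); lra.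
have ab0 : 0 < a + b by lra.
have := ab (a / (a + b)); rewrite divr_gt0//= ltr_pdivrMr// mul1r.
rewrite ltrDl b0 => /(_ isT); rewrite mulrAC ler_pdivlMr// mulrDr; nra.
Qed.

(** Comparing [w] with w + s (z - w), which lies in [A], bounds twice the inner product by s |z -
    w|^2; then s tends to 0. *)
Lemma projection_variational (R : realType) (m : nat) (A : set 'cV[R]_m)
    (u w z : 'cV[R]_m) :
  convex_set A -> is_projection A u w -> A z -> dot (u - w) (z - w) <= 0.
Proof.
move=> cA [Aw minw] Az; rewrite -(pmulr_rle0 _ (ltr0n R 2)).
apply: (@le0_of_le_scaled _ _ (dot (z - w) (z - w))) => s /andP[s0 s1].
have s01 : 0 <= s <= 1 by rewrite !ltW.
have := minw _ (convex_set_segment cA Az Aw s01); rewrite enorm_le.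
rewrite (_ : u - (s *: z + _) = (u - w) - s *: (z - w)); last first.
  by apply/matrixP => i j; rewrite !mxE; ring.
move: (u - w) (z - w) => b c; rewrite !dotE (dotC c b) => le.
rewrite -(ler_pM2l s0); nra.
Qed.

(** * Directional derivatives, gradients and convexity *)

(** The derivative is in particular the limit of the difference quotients from the right, so a bound
    for small positive s passes to the limit. *)
Lemma derive_le_of_secant_le (R : realType) (V : normedModType R) (g : V -> R)
    (x v : V) (c : R) :
  derivable g x v ->
  (forall s, 0 < s < 1 -> g (x + s *: v) - g x <= s * c) -> 'D_v g x <= c.
Proof.
move=> gxv le; apply: cvgr_to_le (cvg_dnbhs_at_right gxv) _.
near=> s.
have s0 : 0 < s by [].
have s1 : s < 1 by near: s; exact: nbhs_right_lt.
rewrite /= [_ *: _]mulrC ler_pdivrMr// mulrC addrC (addrC _ x).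
by rewrite [leLHS]addrC le ?s0.
Unshelve. all: by end_near. Qed.

Lemma cV_linear_continuous (R : realType) (m : nat) (W : normedModType R)
    (g : {linear 'cV[R]_m -> W}) : continuous g.
Proof.
have -> : (g : _ -> _) =
    (fun z : 'cV[R]_m => \sum_k z k 0 *: g (delta_mx k 0)).
  apply/funext => z; rewrite {1}[z]matrix_sum_delta linear_sum.
  by apply: eq_bigr => k _; rewrite big_ord1 linearZ.
apply: continuous_big => [|k _]; first exact: add_continuous.
move=> z; apply: (@continuousZl _ _ _ (fun z : 'cV[R]_m => z k 0)).
exact: coord_continuous.
Qed.

Lemma derive_grad (R : realType) (m : nat) (g : 'cV[R]_m -> R) (x v : 'cV[R]_m) :
  differentiable g x -> 'D_v g x = dot (grad g x) v.
Proof.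
move=> gx; rewrite deriveE// {1}[v]matrix_sum_delta linear_sum /dot.
by apply: eq_bigr => k _; rewrite big_ord1 linearZ mxE deriveE// mulrC.
Qed.

Lemma is_derive_comp_grad (R : realType) (m : nat) (g : 'cV[R]_m -> R)
    (X : R -> 'cV[R]_m) (t : R) (dX : 'cV[R]_m) :
  differentiable g (X t) -> is_derive t 1 X dX ->
  is_derive t 1 (g \o X) (dot (grad g (X t)) dX).
Proof.
move=> gX [Xt <-]; have dXt := (derivable1_diffP _ _).1 Xt.
have dgX : differentiable (g \o X) t by exact: differentiable_comp.
split; first exact/derivable1_diffP.
by rewrite -derive_grad// !deriveE// diff_comp.
Qed.

(** Both functions vanish at [t], so the difference quotients of [rho] are squeezed by those of [q].
    It serves for a remainder [rho] with a quadratic bound [q]. *)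
Lemma is_derive0_of_le (R : realType) (rho q : R -> R) (t : R) :
  (forall s, `|rho s| <= q s) -> q t = 0 -> is_derive t 1 q 0 ->
  is_derive t 1 rho 0.
Proof.
move=> le qt [qd q0].
have rhot : rho t = 0.
  by apply/eqP; rewrite -normr_le0 -qt le.
have qlim : (fun h => h^-1 *: ((q \o shift t) (h *: 1) - q t)) @ 0^' --> (0 : R).
  by move: (qd : _ --> 'D_1 q t); rewrite q0.
have lim0 : (fun h => h^-1 *: ((rho \o shift t) (h *: 1) - rho t)) @ 0^'
    --> (0 : R).
  apply/cvgr0Pnorm_lt => /= eps eps0; near=> h.
  rewrite rhot subr0 normrZ.
  have : `|h^-1 *: ((q \o shift t) (h *: 1) - q t)| < eps.
    by near: h; move/cvgr0Pnorm_lt : qlim; apply.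
  apply: le_lt_trans; rewrite qt subr0 normrZ ler_wpM2l//.
  by rewrite (le_trans (le _))// ler_norm.
split; first by apply/cvg_ex; exists 0.
exact: cvg_lim lim0.
Unshelve. all: by end_near. Qed.

Lemma grad_le_of_convex (R : realType) (m : nat) (g : 'cV[R]_m -> R)
    (x z : 'cV[R]_m) :
  differentiable g x ->
  (forall s, 0 < s < 1 -> g (s *: z + (1 - s) *: x) <= s * g z + (1 - s) * g x) ->
  dot (grad g x) (z - x) <= g z - g x.
Proof.
move=> gx cvx; rewrite -derive_grad//.
apply: derive_le_of_secant_le => [|s s01]; first exact: diff_derivable.
have := cvx s s01; rewrite (_ : s *: z + _ = x + s *: (z - x)); first lra.
by apply/matrixP => i j; rewrite !mxE; ring.
Qed.

(** First-order optimality along one segment: the secant bound with c = 0 is applied to - g. *)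
Lemma is_derive_ge0_of_min (R : realType) (m : nat) (g : 'cV[R]_m -> R)
    (x z : 'cV[R]_m) (d : R) :
  is_derive x (z - x) g d ->
  (forall s, 0 < s < 1 -> g x <= g (s *: z + (1 - s) *: x)) -> 0 <= d.
Proof.
move=> [gx <-] minx; rewrite -oppr_le0 -deriveN//.
apply: derive_le_of_secant_le => [|s s01]; first exact: derivableN.
rewrite mulr0 (_ : _ + _ *: _ = s *: z + (1 - s) *: x).
  by rewrite opprfctE; have := minx s s01; lra.
by apply/matrixP => i j; rewrite !mxE; ring.
Qed.

(** The [?= iff] form records the weak inequality together with its equality case, so that both can
    be summed over the blocks. *)
Lemma strictly_convex_on_leif (R : realType) (m : nat) (A U : set 'cV[R]_m)
    (g : 'cV[R]_m -> R) :
  convex_set A -> A `<=` U -> strictly_convex_on U g ->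
  forall z w s, A z -> A w -> 0 < s < 1 ->
    g (s *: z + (1 - s) *: w) <= s * g z + (1 - s) * g w
      ?= iff (z == w).
Proof.
move=> cA AU cg z w s Az Aw s01.
have [<-|zw] := eqVneq z w.
  rewrite -scalerDl -mulrDl (addrC s) subrK scale1r mul1r; exact/leif_refl.
apply/leifP => /=; apply: cg => //; [exact: AU..|].
by move=> s' s'01; apply: AU; exact: convex_set_segment.
Qed.

(** * Stacked vectors and their blocks *)

Section Blocks.
Context {R : realType} {n p : nat}.
Implicit Types x y z : 'cV[R]_(n * p).

Lemma block_is_linear i : linear (@block R n p i).
Proof. by move=> c x y; apply/matrixP => j k; rewrite !mxE. Qed.

HB.instance Definition _ i :=
  GRing.isLinear.Build R 'cV[R]_(n * p) 'cV[R]_p *:%R (@block R n p i)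
    (block_is_linear i).

Lemma block_inj x y : (forall i, block i x = block i y) -> x = y.
Proof.
move=> xy; apply/matrixP => k j; rewrite ord1.
case: (mxtens_indexP k) => i l.
by have /matrixP/(_ l 0) := xy i; rewrite !mxE.
Qed.

Lemma sum_blocks (h : 'I_(n * p) -> R) :
  \sum_k h k = \sum_i \sum_l h (mxtens_index (i, l)).
Proof.
rewrite pair_big (reindex (@mxtens_index n p))/=; last first.
  by exists (@mxtens_unindex n p) => k _;
    [exact: mxtens_indexK|exact: mxtens_unindexK].
by apply: eq_bigr => -[].
Qed.

Lemma dot_blocks x y : dot x y = \sum_i dot (block i x) (block i y).
Proof.
rewrite /dot sum_blocks; apply: eq_bigr => i _; apply: eq_bigr => l _.
by rewrite !mxE.
Qed.

Definition unblock (F : 'I_n -> 'cV[R]_p) : 'cV[R]_(n * p) :=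
  \col_k F (mxtens_unindex k).1 (mxtens_unindex k).2 0.

Lemma unblockK F i : block i (unblock F) = F i.
Proof. by apply/matrixP => k j; rewrite !mxE mxtens_indexK ord1. Qed.

Lemma prod_set_segment (Omega : 'I_n -> set 'cV[R]_p) :
  (forall i, convex_set (Omega i)) -> forall z w (s : R),
  prod_set Omega z -> prod_set Omega w -> 0 <= s <= 1 ->
  prod_set Omega (s *: z + (1 - s) *: w).
Proof.
by move=> cO z w s Oz Ow s01 i; rewrite linearD !linearZ; apply: convex_set_segment.
Qed.

Lemma prod_set_closed (Omega : 'I_n -> set 'cV[R]_p) :
  (forall i, closed (Omega i)) -> closed (prod_set Omega).
Proof.
move=> cO; rewrite (_ : prod_set Omega = \bigcap_i (@block R n p i @^-1` Omega i)).
  apply: closed_bigI => i _; apply: preimage_closed => // z _.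
  exact: cV_linear_continuous.
by apply/seteqP; split => [z Oz i _|z Oz i]; [exact: Oz|exact: (Oz i)].
Qed.

Lemma differentiable_total_cost (f : 'I_n -> 'cV[R]_p -> R) x :
  (forall i, differentiable (f i) (block i x)) ->
  differentiable (total_cost f) x.
Proof.
move=> df; rewrite (_ : total_cost f = \sum_i (f i \o block i)); last first.
  by apply/funext => z; rewrite fct_sumE.
apply: differentiable_sum => i; apply: differentiable_comp; last exact: df.
by apply: linear_differentiable; exact: cV_linear_continuous.
Qed.

End Blocks.

(** * The quadratic form of the Laplacian *)

Section Laplacian.
Context {R : realType} {n : nat} (p : nat) {e : rel 'I_n} {a : 'M[R]_n}.
Hypothesis ga : connected_weighted_graph e a.

Lemma bigL_sym : (bigL p a)^T = bigL p a.
Proof.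
have [_ _ asym _] := ga.
rewrite /bigL trmx_tens trmx1 /laplacian linearB/= tr_diag_mx.
by congr ((_ - _) *t _); apply/matrixP => i j; rewrite mxE asym.
Qed.

Lemma dot_bigL (x y : 'cV[R]_(n * p)) :
  dot x (bigL p a *m y) = dot (bigL p a *m x) y.
Proof. by rewrite dot_trmx_mul bigL_sym. Qed.

Lemma bigL_mulE (x : 'cV[R]_(n * p)) i k :
  (bigL p a *m x) (mxtens_index (i, k)) 0 =
  \sum_j a i j * (x (mxtens_index (i, k)) 0 - x (mxtens_index (j, k)) 0).
Proof.
rewrite mxE sum_blocks.
transitivity (\sum_j laplacian a i j * x (mxtens_index (j, k)) 0).
  apply: eq_bigr => j _; rewrite (bigD1 k)//= big1 => [|l lk].
    by rewrite addr0 tensmxE [1%:M _ _]mxE eqxx mulr1.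
  by rewrite tensmxE [1%:M _ _]mxE eq_sym (negbTE lk) mulr0 mul0r.
under eq_bigr do rewrite /laplacian !mxE mulrBl.
rewrite sumrB [X in X - _](bigD1 i)//= eqxx mulr1n.
rewrite [X in _ + X - _]big1 => [|j ji]; last first.
  by rewrite eq_sym (negbTE ji) mulr0n mul0r.
rewrite addr0 mulr_suml -sumrB.
by apply: eq_bigr => j _; rewrite mulrBr.
Qed.

(** Twice the form is the sum of a_ij |x_i - x_j|^2 over all ordered pairs, with nonnegative
    weights. *)
Lemma bigL_psd (x : 'cV[R]_(n * p)) : 0 <= dot x (bigL p a *m x).
Proof.
have [_ _ asym apos] := ga.
rewrite -(pmulr_rge0 _ (ltr0n R 2)).
rewrite (_ : _ * _ = \sum_i \sum_j \sum_k
    a i j * (x (mxtens_index (i, k)) 0 - x (mxtens_index (j, k)) 0) ^+ 2).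
  apply: sumr_ge0 => i _; apply: sumr_ge0 => j _; apply: sumr_ge0 => k _.
  rewrite mulr_ge0 ?sqr_ge0//; have [eij|eij] := boolP (e i j).
    by rewrite ltW// (apos i j).1.
  by rewrite (apos i j).2.
have eqd : dot x (bigL p a *m x) = \sum_i \sum_j \sum_k
    a i j * (x (mxtens_index (i, k)) 0 *
    (x (mxtens_index (i, k)) 0 - x (mxtens_index (j, k)) 0)).
  rewrite /dot sum_blocks; apply: eq_bigr => i _; rewrite exchange_big/=.
  apply: eq_bigr => k _; rewrite bigL_mulE mulr_sumr.
  by apply: eq_bigr => j _; rewrite mulrCA.
(* One of the two copies of the form has i and j exchanged; by symmetry of [a] the two add up to
   squares. *)
rewrite mulr2n mulrDl mul1r eqd [X in X + _]exchange_big/= -big_split/=.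
apply: eq_bigr => i _; rewrite -big_split/=; apply: eq_bigr => j _.
rewrite -big_split/=; apply: eq_bigr => k _.
by rewrite (asym j i); ring.
Qed.

End Laplacian.

Lemma dot_mulmx_le (R : realType) (m : nat) (B : 'M[R]_m) (z : 'cV[R]_m) :
  dot z (B *m z) <= (\sum_i \sum_j `|B i j|) * dot z z.
Proof.
rewrite /dot mulr_suml ler_sum// => i _; rewrite mxE mulr_sumr mulr_suml.
apply: ler_sum => j _; rewrite mulrCA -/(dot z z).
rewrite (le_trans (ler_norm _))// normrM ler_wpM2l//.
have := sqr_le_dot z i; have := sqr_le_dot z j; rewrite ler_norml; nra.
Qed.

(** Positivity of the form at z - M^-1 B z gives 2 M |Bz|^2 <= M^2 z^T B z + (Bz)^T B (Bz), and the
    last term is at most (M - 1) |Bz|^2. The summand 1 in [M] makes it positive. *)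
Lemma dot_mulmx_sqr_le (R : realType) (m : nat) (B : 'M[R]_m) :
  B^T = B -> (forall z, 0 <= dot z (B *m z)) ->
  exists2 M, 0 < M & forall z, dot (B *m z) (B *m z) <= M * dot z (B *m z).
Proof.
move=> Bsym psd; pose M := 1 + \sum_i \sum_j `|B i j|.
have M0 : 0 < M.
  by rewrite ltr_wpDr//; apply: sumr_ge0 => i _; exact: sumr_ge0.
exists M => // z; have := psd (z - M^-1 *: (B *m z)).
have := dot_mulmx_le B (B *m z); have := dot_ge0 (B *m z).
rewrite mulmxBr -scalemxAr !dotE (dot_trmx_mul B z (B *m z)) Bsym.
have -> : \sum_i \sum_j `|B i j| = M - 1 by rewrite /M [1 + _]addrC addrK.
move: (dot (B *m z) (B *m (B *m z))) (dot (B *m z) (B *m z)) (dot z _).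
move=> c b d b0 cb.
rewrite [X in 0 <= X -> _](_ : _ = (M * (M * d) - M * b *+ 2 + c) / (M * M)).
  rewrite pmulr_lge0 ?invr_gt0 ?mulr_gt0// => h; rewrite -(ler_pM2l M0); lra.
by field; rewrite gt_eqF.
Qed.

(** * Monotone quantities and an invariant convex set *)

Lemma continuous_dotr (R : realType) (m : nat) (c : 'cV[R]_m) : continuous (dot c).
Proof.
apply: continuous_big => [|k _]; first exact: add_continuous.
by move=> z; apply: continuousM; [exact: cst_continuous|exact: coord_continuous].
Qed.

Lemma is_derive_linear (R : realType) (m : nat) (V W : normedModType R)
    (L : {linear 'cV[R]_m -> W}) (X : V -> 'cV[R]_m) (t v : V) dX :
  is_derive t v X dX -> is_derive t v (L \o X) (L dX).
Proof.
move=> [Xt <-].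
have limL : (fun h => h^-1 *: ((L \o X \o shift t) (h *: v) - (L \o X) t)) @ 0^'
    --> L ('D_v X t).
  rewrite (_ : (fun h => _) =
      L \o (fun h => h^-1 *: ((X \o shift t) (h *: v) - X t))); last first.
    by apply/funext => h /=; rewrite linearZ; congr (_ *: _); exact/esym/linearB.
  by apply: (cvg_comp _ _ (Xt : _ --> 'D_v X t)); exact: cV_linear_continuous.
split; first by apply/cvg_ex; exists (L ('D_v X t)).
exact: cvg_lim limL.
Qed.

Lemma nonincreasing_of_is_derive_le0 (R : realType) (g : R -> R) :
  (forall t : R, 0 < t -> exists2 d, is_derive t 1 g d & d <= 0) ->
  forall s t : R, 0 < s -> s <= t -> g t <= g s.
Proof.
move=> dg s t s0 st.
have gd u : 0 < u -> derivable g u 1 by move=> /dg[d []].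
apply: (@ler0_derive1_nincry _ g s) => //.
- by move=> u; rewrite in_itv/= andbT => su; apply: gd; exact: lt_trans su.
- move=> u; rewrite in_itv/= andbT => su.
  by have [d [_ gu] d0] := dg _ (lt_trans s0 su); rewrite derive1E gu.
- apply: derivable_within_continuous => u; rewrite in_itv/= andbT => su.
  by apply: gd; exact: lt_le_trans su.
Qed.

(* x is a weighted mean of the past values of w, which is exploited without
   integrating: given a hyperplane separating a point x t from A, s ^ r times the
   signed distance of x s to the hyperplane is nonincreasing in s. *)
Lemma averaging_flow_in_convex (R : realType) (m : nat) (A : set 'cV[R]_m)
    (r : R) (x w : R -> 'cV[R]_m) :
  closed A -> convex_set A -> 0 <= r ->
  {within `[0%R, +oo[%classic, continuous x} -> A (x 0) ->
  (forall t : R, 0 < t -> A (w t)) ->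
  (forall t : R, 0 < t -> is_derive t 1 x ((r / t) *: (w t - x t))) ->
  forall t : R, 0 <= t -> A (x t).
Proof.
move=> cA cvA r0 xc Ax0 Aw dx t; rewrite le_eqVlt => /predU1P[<-//|t0].
have [q qP] := ex_projection (x t) cA (ex_intro _ _ Ax0).
have [Aq _] := qP.
pose c := x t - q; pose phi s := dot c (x s - q).
have [c0|cN0] := eqVneq c 0; first by rewrite -[x t](subrK q) -/c c0 add0r.
have phit : 0 < phi t by exact: dot_gt0.
have sep z : A z -> dot c (z - q) <= 0 by exact: projection_variational.
have dphi (s : R) : 0 < s ->
    is_derive s 1 phi ((r / s) * (dot c (w s - q) - phi s)).
  move=> s0.
  have dxq : is_derive s 1 (fun s => x s - q) ((r / s) *: (w s - x s)).
    have := is_deriveB (dx s s0) (is_derive_cst q s 1); rewrite subr0.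
    exact.
  apply: (is_derive_eq (is_derive_dot (is_derive_cst c s 1) dxq)).
  by rewrite /phi dotC dot0r add0r /= !dotE; ring.
pose g := fun s => expR (r * ln s) * phi s.
have gdec : forall s1 s2 : R, 0 < s1 -> s1 <= s2 -> g s2 <= g s1.
  apply: nonincreasing_of_is_derive_le0 => s s0.
  have dexp : is_derive s 1 (fun s => expR (r * ln s)) (expR (r * ln s) * (r / s)).
    exact: (is_derive1_comp (is_derive_expR _) (is_deriveZ r (is_derive1_ln s0))).
  eexists; first exact: (is_deriveM dexp (dphi s s0)).
  rewrite [leLHS](_ : _ = expR (r * ln s) * (r / s * dot c (w s - q))).
    rewrite pmulr_rle0 ?expR_gt0// mulr_ge0_le0 ?divr_ge0 ?(ltW s0)//.
    by rewrite sep//; exact: Aw.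
  by rewrite /GRing.scale/=; ring.
have phi0 : phi s @[s --> 0^'+] --> phi 0.
  have [_ x0] := (continuous_within_itvcyP 0 x).1 xc.
  have xq : x s - q @[s --> 0^'+] --> x 0 - q by apply: cvgB x0 _; exact: cvg_cst.
  exact: (cvg_comp _ _ xq (@continuous_dotr _ _ c _)).
have phi0le : phi 0 <= 0 by exact: sep.
(* As s decreases to 0, [phi s] tends to phi 0 <= 0 < phi t. For small s both factors of [g s] are
   thus bounded by those of [g t], the second strictly, against the monotonicity of [g]. *)
exfalso; have : \forall s \near 0^'+, phi s < phi t.
  by apply: (cvgr_lt _ phi0); exact: le_lt_trans phit.
move=> near_lt; near (0:R)^'+ => s.
have s0 : 0 < s by [].
have st : s <= t by near: s; exact: nbhs_right_le.
have := gdec s t s0 st; apply/negP; rewrite -ltNge /g.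
have lns : expR (r * ln s) <= expR (r * ln t).
  by rewrite ler_expR ler_wpM2l// ler_ln.
have phis : phi s < phi t by near: s.
apply: (@lt_le_trans _ _ (expR (r * ln s) * phi t)).
  by rewrite ltr_pM2l ?expR_gt0.
by rewrite ler_wpM2r// ltW.
Unshelve. all: by end_near. Qed.

(** * Differentiability of half the squared distance to a convex set *)

Section HalfSquaredDistance.
Context {R : realType} {m : nat} {A : set 'cV[R]_m} {W : 'cV[R]_m -> 'cV[R]_m}.
Hypothesis AW : forall u, A (W u).
Hypothesis Wvar : forall u z, A z -> dot (u - W u) (z - W u) <= 0.

(** Let b and c be the residuals u - W u at [u2] and [u1], and d = W u2 - W u1. The remainder is |b
    - c|^2 / 2 - c.d, and the variational inequalities give c.d <= 0 <= b.d. So the gradient is u -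
    W u, even where [W] has no derivative. *)
Lemma half_sqr_dist_expansion u1 u2 :
  `|2^-1 * dot (u2 - W u2) (u2 - W u2) - 2^-1 * dot (u1 - W u1) (u1 - W u1)
    - dot (u1 - W u1) (u2 - u1)| <= dot (u2 - u1) (u2 - u1).
Proof.
have h1 := Wvar u1 (AW u2); have h2 := Wvar u2 (AW u1).
have p0 := dot_ge0 (u2 - W u2 - (u1 - W u1)); have w0 := dot_ge0 (W u2 - W u1).
move: h1 h2 p0 w0.
have -> : u2 - u1 = (u2 - W u2) - (u1 - W u1) + (W u2 - W u1).
  by apply/matrixP => i j; rewrite !mxE; ring.
have -> : W u1 - W u2 = - (W u2 - W u1) by rewrite opprB.
move: (u2 - W u2) (u1 - W u1) (W u2 - W u1) => b c d.
rewrite ler_norml !dotE (dotC c b) (dotC d b) (dotC d c); lra.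
Qed.

(** The function is its value at [t], plus a linear term in U s - U t, plus a remainder bounded by
    |U s - U t|^2, whose derivative at [t] is 0. *)
Lemma is_derive_half_sqr_dist (U : R -> 'cV[R]_m) (t : R) dU :
  is_derive t 1 U dU ->
  is_derive t 1 (fun s => 2^-1 * dot (U s - W (U s)) (U s - W (U s)))
    (dot (U t - W (U t)) dU).
Proof.
move=> Ut; pose H s := 2^-1 * dot (U s - W (U s)) (U s - W (U s)).
have dUt : is_derive t 1 (fun s => U s - U t) dU.
  by have := is_deriveB Ut (is_derive_cst (U t) t 1); rewrite subr0; exact.
have dq := is_derive_dot dUt dUt; rewrite subrr dot0r dotC dot0r addr0 in dq.
have dk := is_derive_dot (is_derive_cst (U t - W (U t)) t 1) dUt.
rewrite dotC dot0r add0r in dk.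
have q0 : dot (U t - U t) (U t - U t) = 0 by rewrite subrr dot0r.
have drho := is_derive0_of_le (fun s => half_sqr_dist_expansion (U t) (U s))
  q0 dq.
have := is_deriveD (is_deriveD drho (is_derive_cst (H t) t 1)) dk.
rewrite !add0r; congr (is_derive _ _ _ _).
by apply/funext => s; rewrite !fctE; rewrite /H; ring.
Qed.

End HalfSquaredDistance.

(** * The Lyapunov function and the decay of the gap *)

Section Lyapunov.
Context {R : realType} {m : nat} {A : set 'cV[R]_m} {W : 'cV[R]_m -> 'cV[R]_m}.
Context {F : 'cV[R]_m -> R} {B : 'M[R]_m} {r : R} {x u v : R -> 'cV[R]_m}.
Context {xs ys : 'cV[R]_m}.
Hypothesis AW : forall z, A (W z).
Hypothesis Wvar : forall w z, A z -> dot (w - W w) (z - W w) <= 0.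
Hypothesis dF : forall z, A z -> differentiable F z.
Hypothesis cvxF : forall z w, A z -> A w -> dot (grad F z) (w - z) <= F w - F z.
Hypothesis Bsym : B^T = B.
Hypothesis Bpsd : forall z, 0 <= dot z (B *m z).
Hypothesis r2 : 2 <= r.
Hypothesis Ax : forall t : R, 0 <= t -> A (x t).
Hypothesis dx : forall t : R, 0 < t ->
  is_derive t 1 x ((r / t) *: (W (u t) - x t)).
Hypothesis du : forall t : R, 0 < t ->
  is_derive t 1 u ((t / r) *: (- (grad F (x t) + B *m v t + B *m x t)
                               + W (u t) - u t)).
Hypothesis dv : forall t : R, 0 < t -> is_derive t 1 v ((t / r) *: (B *m W (u t))).
Hypothesis Axs : A xs.
Hypothesis Bxs : B *m xs = 0.

(** For F the total cost and B the matrix [bigL], this is S1(z, ys) - S1(xs, w) for every w, since B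
    xs = 0. The flow can therefore be stated with v in place of y. *)
Definition lagrangian_gap z : R :=
  F z - F xs + dot ys (B *m z) + 2^-1 * dot z (B *m z).
Hypothesis gap_ge0 : forall z, A z -> 0 <= lagrangian_gap z.

(** Subtracting half the squared distance turns the gradient u - xs into W u - xs, which matches the
    W u in the equation of x. *)
Definition energy t : R :=
  2^-1 * dot (u t - xs) (u t - xs)
  - 2^-1 * dot (u t - W (u t)) (u t - W (u t))
  + 2^-1 * dot (v t - ys) (v t - ys).

(** Splitting u - xs at W u leaves |W u - xs|^2 / 2 and a cross term, nonnegative by the variational
    inequality at [xs]. *)
Lemma energy_ge0 t : 0 <= energy t.
Proof.
have h1 := Wvar (u t) Axs; have h2 := dot_ge0 (W (u t) - xs).
have h3 := dot_ge0 (v t - ys); move: h1 h2 h3; rewrite /energy.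
have -> : u t - xs = (u t - W (u t)) + (W (u t) - xs) by rewrite addrA subrK.
rewrite -(opprB (W (u t)) xs).
move: (u t - _) (W (u t) - xs) => b c; rewrite !dotE (dotC c b); lra.
Qed.

Lemma is_derive_energy (t : R) : 0 < t ->
  is_derive t 1 energy
    (dot (W (u t) - xs) ((t / r) *: (- (grad F (x t) + B *m v t + B *m x t)
                               + W (u t) - u t))
     + dot (v t - ys) ((t / r) *: (B *m W (u t)))).
Proof.
move=> t0.
have shift (X : R -> 'cV[R]_m) c dX : is_derive t 1 X dX ->
    is_derive t 1 (fun s => X s - c) dX.
  by move=> Xt; have := is_deriveB Xt (is_derive_cst c t 1); rewrite subr0; exact.
have half (X : R -> 'cV[R]_m) c dX : is_derive t 1 X dX ->
    is_derive t 1 (fun s => 2^-1 * dot (X s - c) (X s - c)) (dot (X t - c) dX).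
  move=> /(shift _ c) Xt.
  apply: (is_derive_eq (is_deriveZ 2^-1 (is_derive_dot Xt Xt))).
  by rewrite /GRing.scale/= (dotC dX); field.
have := is_deriveD (is_deriveB (half _ xs _ (du t0))
  (is_derive_half_sqr_dist AW Wvar (du t0))) (half _ ys _ (dv t0)).
move=> H; apply: (is_derive_eq H); congr (_ + _).
by rewrite -dotNl -dotDl; congr dot; rewrite opprB addrC addrA subrK.
Qed.

Lemma is_derive_gap (t : R) : 0 < t ->
  is_derive t 1 (lagrangian_gap \o x)
    (dot (grad F (x t) + B *m ys + B *m x t) ((r / t) *: (W (u t) - x t))).
Proof.
move=> t0; have Axt := Ax (ltW t0); move: (dx t0).
move: (_ *: (W (u t) - x t)) => d xt.
have Bxt := is_derive_linear (mulmx B) xt.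
have H := is_deriveD (is_deriveD (is_deriveB (is_derive_comp_grad (dF Axt) xt)
  (is_derive_cst (F xs) t 1)) (is_derive_dot (is_derive_cst ys t 1) Bxt))
  (is_deriveZ 2^-1 (is_derive_dot xt Bxt)).
apply: (is_derive_eq H); rewrite /= /GRing.scale/=.
rewrite subr0 (dotC 0) dot0r add0r !dotDl.
by rewrite (dotC d (_ *m _)) !(dot_trmx_mul B) Bsym; field.
Qed.

Lemma gap_decay :
  exists C, forall t : R, 1 <= t -> lagrangian_gap (x t) <= C / t ^+ 2.
Proof.
(* This is r^2 times the function of the overview, to avoid the quotient t / r. *)
pose V t := t * t * lagrangian_gap (x t) + r ^+ 2 * energy t.
have r0 : 0 < r by exact: lt_le_trans r2.
have Vdec : forall s t : R, 0 < s -> s <= t -> V t <= V s.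
  apply: nonincreasing_of_is_derive_le0 => t t0.
  have H := is_deriveD (is_deriveM (is_deriveM (is_derive_id t (1 : R))
    (is_derive_id t (1 : R))) (is_derive_gap t0))
    (is_deriveZ (r ^+ 2) (is_derive_energy t0)).
  eexists; first exact: H.
  have Axt := Ax (ltW t0).
  have h1 := cvxF Axt Axs; have h2 := Wvar (u t) Axs; have h3 := gap_ge0 Axt.
  have h4 := Bpsd (x t); move: h1 h2 h3; rewrite /GRing.scale/=.
  have Bzxs z : dot xs (B *m z) = 0.
    by rewrite dot_trmx_mul Bsym Bxs dotC dot0r.
  have Bxy : dot (B *m ys) (x t) = dot ys (B *m x t) by rewrite dot_trmx_mul Bsym.
  have Bwy : dot (B *m ys) (W (u t)) = dot ys (B *m W (u t)).
    by rewrite dot_trmx_mul Bsym.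
  have Bvw : dot (v t) (B *m W (u t)) = dot (W (u t)) (B *m v t).
    by rewrite dot_trmx_mul Bsym dotC.
  have Bwx : dot (B *m x t) (W (u t)) = dot (W (u t)) (B *m x t) by rewrite dotC.
  have Bxx : dot (B *m x t) (x t) = dot (x t) (B *m x t) by rewrite dotC.
  rewrite !dotE !Bzxs Bxy Bwy Bvw Bwx Bxx (dotC (W (u t)) (grad F (x t))).
  rewrite (dotC xs (grad F (x t))) (dotC (W (u t)) (u t)).
  rewrite (dotC xs (W (u t))) (dotC xs (u t)).
  rewrite /comp.
  set G := lagrangian_gap (x t) => h1 h2 h3.
  have GE : G = F (x t) - F xs + dot ys (B *m x t) + 2^-1 * dot (x t) (B *m x t).
    by [].
  rewrite [(id * id) t](_ : _ = t * t)//.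
  (* What is left after the terms in B v, and those pairing W u with the gradient of the gap, have
     cancelled: the derivative of [V] is t (r K + 2 G). The last bracket is the product of u - W u
     and xs - W u. *)
  pose K := dot (grad F (x t)) xs - dot (grad F (x t)) (x t)
    - dot ys (B *m x t) - dot (x t) (B *m x t)
    + (dot (W (u t)) (W (u t)) - dot (u t) (W (u t))
       - dot (W (u t)) xs + dot (u t) xs).
  (* Convexity of F from x towards [xs] and the projection inequality give K <= - G - x^T B x / 2.
     With r >= 2 and G >= 0, r K + 2 G <= 0 follows. *)
  have KG : K <= - G by rewrite GE /K; lra.
  rewrite [leLHS](_ : _ = t * (r * K + 2 * G)).
    rewrite mulr_ge0_le0 ?(ltW t0)//.
    have : r * K <= r * - G by rewrite ler_pM2l.
    have : 2 * G <= r * G by rewrite ler_wpM2r.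
    lra.
  by rewrite /K; field; rewrite !gt_eqF.
(* Monotonicity is available at positive times only, hence the start at time 1. As [energy] is
   nonnegative, t^2 times the gap is at most [V t]. *)
exists (V 1) => t t1; have t0 : 0 < t by exact: lt_le_trans t1.
rewrite ler_pdivlMr ?exprn_gt0// mulrC expr2.
apply: le_trans (Vdec 1 t ltr01 t1); rewrite /V lerDl.
by rewrite mulr_ge0 ?energy_ge0// sqr_ge0.
Qed.

End Lyapunov.

(** * Convergence to a strict minimiser *)

(** By compactness [g] has a positive lower bound d on the points of [A] at distance eps from [xs].
    If x t were at distance eps or more, the segment to [xs] would meet that sphere at a point where
    [g] is at most g (x t) < d. *)
Lemma cvg_of_convex_min (R : realType) (m : nat) (A : set 'cV[R]_m)
    (g : 'cV[R]_m -> R) (x : R -> 'cV[R]_m) (xs : 'cV[R]_m) :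
  closed A -> convex_set A -> {in A, continuous g} ->
  A xs -> (forall z, A z -> z != xs -> 0 < g z) ->
  (forall z s, A z -> 0 < s <= 1 -> g (s *: z + (1 - s) *: xs) <= s * g z) ->
  (\forall t \near +oo, A (x t)) ->
  (forall d, 0 < d -> \forall t \near +oo, g (x t) < d) ->
  x t @[t --> +oo] --> xs.
Proof.
move=> cA cvA gc Axs gpos gcvx Ax gx0; apply/cvgrPdist_lt => /= eps eps0.
pose K := A `&` (fun z => `|xs - z|) @^-1` [set c | c = eps].
have [d d0 dK] : exists2 d, 0 < d & forall z, K z -> d <= g z.
  have [->|K0] := eqVneq K set0; first by exists 1.
  have cK : compact K.
    apply: cV_bounded_closed_compact.
      exists (`|xs| + eps); split; first exact: num_real.
      move=> M ltM z [_ /= zeps]; apply: le_trans (ltW ltM).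
      by rewrite -[z](subKr xs) (le_trans (ler_normB _ _))// zeps.
    apply: closedI => //; apply: preimage_closed; last exact: closed_eq.
    move=> z _.
    exact: (cvg_norm (@continuous_subr _ _ xs z)).
  have gK : {within K, continuous g}.
    apply: continuous_in_subspaceT => z; rewrite inE => -[Az _].
    by apply: gc; rewrite inE.
  have [c] := compact_EVT_min ((set0P _).1 K0) cK gK.
  rewrite inE => -[Ac ceps] cmin; exists (g c).
    apply: gpos => //; apply: contraTneq eps0 => cxs.
    by rewrite -ceps cxs subrr normr0 ltxx.
  by move=> z Kz; apply: cmin; rewrite inE.
near=> t; rewrite ltNge; apply/negP => le_eps.
have At : A (x t) by near: t.
have gt : g (x t) < d by near: t; exact: gx0.
have n0 : 0 < `|xs - x t| by exact: lt_le_trans le_eps.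
(* The weight that puts the point of the segment at distance exactly eps from [xs]. *)
pose s := eps / `|xs - x t|.
have s01 : 0 < s <= 1 by rewrite divr_gt0//= ler_pdivrMr// mul1r.
have /andP[s0 s1] := s01.
have Kz : K (s *: x t + (1 - s) *: xs).
  split; first by apply: convex_set_segment => //; rewrite ltW.
  rewrite /= (_ : xs - _ = s *: (xs - x t)).
    by rewrite normrZ gtr0_norm// /s divfK// gt_eqF.
  by apply/matrixP => i j; rewrite !mxE; ring.
have := le_trans (dK _ Kz) (gcvx _ _ At s01); apply/negP; rewrite -ltNge.
apply: le_lt_trans gt; rewrite ler_piMl// ltW// gpos// eq_sym -subr_eq0.
by rewrite -normr_gt0.
Unshelve. all: by end_near. Qed.

(** * Partial gradients of [S1] *)

Lemma dot_delta (R : realType) (m : nat) (z : 'cV[R]_m) k :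
  dot z (delta_mx k 0) = z k 0.
Proof.
rewrite /dot (bigD1 k)//= mxE !eqxx mulr1 big1 ?addr0// => j jk.
by rewrite mxE (negbTE jk) mulr0.
Qed.

Lemma grad_of_is_derive (R : realType) (m : nat) (g : 'cV[R]_m -> R)
    (x w : 'cV[R]_m) :
  (forall d, is_derive x d g (dot w d)) -> grad g x = w.
Proof.
move=> gx; apply/matrixP => k j; rewrite ord1 mxE -dot_delta.
by have [_ ->] := gx (delta_mx k 0).
Qed.

Section SaddleFunction.
Context {R : realType} {n p : nat} {e : rel 'I_n} {a : 'M[R]_n}.
Context {f : 'I_n -> 'cV[R]_p -> R}.
Hypothesis ga : connected_weighted_graph e a.
Local Notation B := (bigL p a).
Implicit Types x y : 'cV[R]_(n * p).

Lemma S1E x y :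
  S1 a f x y = total_cost f x + dot y (B *m x) + 2^-1 * dot x (B *m x).
Proof. by rewrite /S1 -!mulmxA !dot_mulmx. Qed.

Lemma is_derive_S1l x y d : differentiable (total_cost f) x ->
  is_derive x d (fun z => S1 a f z y)
    (dot (grad (total_cost f) x + B *m y + B *m x) d).
Proof.
move=> dF.
have Bid := is_derive_linear (mulmx B) (is_derive_id x d).
have dFx : is_derive x d (total_cost f) (dot (grad (total_cost f) x) d).
  by rewrite -derive_grad//; exact/derivableP/diff_derivable.
have H := is_deriveD (is_deriveD dFx (is_derive_dot (is_derive_cst y x d) Bid))
  (is_deriveZ 2^-1 (is_derive_dot (is_derive_id x d) Bid)).
rewrite (_ : (fun z => _) = total_cost f + (fun z => dot y (B *m z))
   + 2^-1 \*: (fun z => dot z (B *m z))); last first.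
  by apply/funext => z; rewrite S1E.
apply: (is_derive_eq H); rewrite /= /GRing.scale/=.
rewrite (dotC 0) dot0r add0r !dotDl.
by rewrite (dotC d (_ *m _)) !(dot_bigL ga); field.
Qed.

Lemma is_derive_S1r x y d : is_derive y d (fun z => S1 a f x z) (dot (B *m x) d).
Proof.
have H := is_deriveD (is_deriveD (is_derive_cst (total_cost f x) y d)
  (is_derive_dot (is_derive_id y d) (is_derive_cst (B *m x) y d)))
  (is_derive_cst (2^-1 * dot x (B *m x)) y d).
rewrite (_ : (fun z => _) = cst (total_cost f x) + (fun z => dot z (B *m x))
   + cst (2^-1 * dot x (B *m x))); last first.
  by apply/funext => z; rewrite S1E.
by apply: (is_derive_eq H); rewrite dot0r /= add0r !addr0 dotC.
Qed.

End SaddleFunction.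

(** A coarse Cauchy-Schwarz inequality: any constant depending on [y] alone is enough for a rate. *)
Lemma norm_dot_le (R : realType) (m : nat) (y z : 'cV[R]_m) :
  `|dot y z| <= (\sum_k `|y k 0|) * enorm z.
Proof.
rewrite (le_trans (ler_norm_sum _ _ _))// mulr_suml ler_sum// => k _.
rewrite normrM ler_wpM2l// -sqrtr_sqr enormE ler_sqrt ?dot_ge0//.
exact: sqr_le_dot.
Qed.

(** * Projection onto the product set and convexity of the total cost *)

Section ProductProjection.
Context {R : realType} {n p : nat} {Omega : 'I_n -> set 'cV[R]_p}.
Hypothesis cO : forall i, closed (Omega i).
Hypothesis cvO : forall i, convex_set (Omega i).
Hypothesis O0 : prod_set Omega !=set0.

Definition block_proj (u : 'cV[R]_(n * p)) : 'cV[R]_(n * p) :=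
  unblock (fun i => Defs.proj (Omega i) (block i u)).

Let is_proj u i : is_projection (Omega i) (block i u) (block i (block_proj u)).
Proof.
rewrite unblockK; apply: is_projection_proj => //.
by have [z Oz] := O0; exists (block i z).
Qed.

Lemma block_proj_in u : prod_set Omega (block_proj u).
Proof. by move=> i; have [] := is_proj u i. Qed.

Lemma block_proj_variational u z : prod_set Omega z ->
  dot (u - block_proj u) (z - block_proj u) <= 0.
Proof.
move=> Oz; rewrite dot_blocks; apply: sumr_le0 => i _; rewrite !linearB.
exact: (projection_variational (cvO (i := i)) (is_proj u i)).
Qed.

End ProductProjection.

(** Equality in the sum forces equality in every block, so strict convexity of each cost in its own
    block yields that of the total cost. *)
Lemma total_cost_convex (R : realType) (n p : nat) (f : 'I_n -> 'cV[R]_p -> R)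
    (Omega U : 'I_n -> set 'cV[R]_p) :
  (forall i, convex_set (Omega i)) -> (forall i, Omega i `<=` U i) ->
  (forall i, strictly_convex_on (U i) (f i)) ->
  forall (z w : 'cV[R]_(n * p)) s, prod_set Omega z -> prod_set Omega w ->
  0 < s < 1 -> total_cost f (s *: z + (1 - s) *: w)
    <= s * total_cost f z + (1 - s) * total_cost f w ?= iff (z == w).
Proof.
move=> cvO OU cf z w s Oz Ow s01.
rewrite !mulr_sumr -big_split/=.
have -> : (z == w) = [forall (i | true), block i z == block i w].
  apply/eqP/forallP => [-> i|zw]; first by rewrite eqxx.
  by apply: block_inj => i; apply/eqP; exact: zw.
apply: leif_sum => i _; rewrite linearD !linearZ.
exact: (strictly_convex_on_leif (cvO i) (OU i) (cf i) (Oz i) (Ow i) s01).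
Qed.

(** * The dynamics (D1) as an instance of the abstract flow, and the three claims *)

Theorem corollary1 (R : realType) (n p : nat) (r : R) (e : rel 'I_n)
    (a : 'M[R]_n) (f : 'I_n -> 'cV[R]_p -> R) (Omega : 'I_n -> set 'cV[R]_p)
    (u0 v0 : 'cV[R]_(n * p)) (x u y v : R -> 'cV[R]_(n * p))
    (xs us ys vs : 'cV[R]_(n * p)) :
  (0 < n)%N -> (0 < p)%N ->
  connected_weighted_graph e a ->
  2 <= r ->
  assumption_C a f Omega ->
  trajectory r a f Omega u0 v0 x u y v ->
  equilibrium a f Omega xs us ys vs ->
  saddle_point a f Omega xs ys ->
  is_solution a f Omega xs ->
  [/\ vanishes_with_rate 2 (fun t => S1 a f (x t) ys - S1 a f xs (y t)),
      x t @[t --> +oo] --> xs,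
      vanishes_with_rate 1 (fun t => enorm (bigL p a *m x t))
    & vanishes_with_rate 1
        (fun t => `|total_cost f (x t) - total_cost f xs|)].
Proof.
move=> _ _ ga r2 [cvO fU _ _ _] traj _ [Axs saddle] [[Bxs _] _].
have cO i : closed (Omega i) by have [] := cvO i.
have {}cvO i : convex_set (Omega i) by have [] := cvO i.
have {fU}[U fU] := choice fU.
pose A := prod_set Omega; pose W := @block_proj R n p Omega.
pose F := total_cost f; pose B := bigL p a.
have A0 : A !=set0 by exists xs.
have AW := block_proj_in cO A0 : forall z, A (W z).
have Wvar := block_proj_variational cO cvO A0.
have dF z : A z -> differentiable F z.
  move=> Az; apply: differentiable_total_cost => i.
  have [_ OU C1 _] := fU i; exact: (C1 _ (OU _ (Az i))).1.
have cvxF z w s : A z -> A w -> 0 < s < 1 ->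
    F (s *: z + (1 - s) *: w) <= s * F z + (1 - s) * F w ?= iff (z == w).
  apply: (total_cost_convex (U := U) cvO); first by move=> i; have [_ OU] := fU i.
  by move=> i; have [_ _ _ cf] := fU i.
have gradF z w : A z -> A w -> dot (grad F z) (w - z) <= F w - F z.
  move=> Az Aw; apply: grad_le_of_convex => [|s s01]; first exact: dF.
  by have [] := cvxF w z s Aw Az s01.
have cA : closed A by exact: prod_set_closed.
have cvxA z w (s : R) : A z -> A w -> 0 <= s <= 1 -> A (s *: z + (1 - s) *: w).
  exact: prod_set_segment.
have cvA : convex_set A.
  move=> z w s; rewrite !inE => Az Aw; apply: (cvxA _ _ s%:num Az Aw).
  by rewrite ge0 le1.
have Bsym : B^T = B := bigL_sym p ga.
have Bpsd z : 0 <= dot z (B *m z) := bigL_psd ga z.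
have r0 : 0 < r by exact: lt_le_trans r2.
have [[[xc dx] [_ du] [_ dy] [_ dv]] [Au0 x0 _ _ _] ode] := traj.
have xt (t : R) : 0 < t -> derive1 x t = (r / t) *: (W (u t) - x t).
  move=> t0; apply: block_inj => i; have [-> _ _ _] := ode t t0 i.
  rewrite linearZ/=; congr (_ *: _); rewrite linearB/=; congr (_ - _).
  exact/esym/unblockK.
have yt (t : R) : 0 < t -> derive1 y t = (r / t) *: (v t - y t).
  move=> t0; apply: block_inj => i; have [_ -> _ _] := ode t t0 i.
  by rewrite linearZ/=; congr (_ *: _); rewrite linearB.
have scale (t : R) : 0 < t -> t / r * (r / t) = 1.
  by move=> t0; field; rewrite !gt_eqF.
have xw (t : R) : 0 < t -> x t + (t / r) *: derive1 x t = W (u t).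
  by move=> t0; rewrite xt// scalerA scale// scale1r addrC subrK.
have yv (t : R) : 0 < t -> y t + (t / r) *: derive1 y t = v t.
  by move=> t0; rewrite yt// scalerA scale// scale1r addrC subrK.
have Dx (t : R) : 0 < t -> is_derive t 1 x ((r / t) *: (W (u t) - x t)).
  by move=> t0; rewrite -xt// derive1E; exact/derivableP/dx.
(* The equations place only W u in [A]. Membership of x itself gives access to the differentiability
   and convexity of F and to the saddle inequality. *)
have Ax (t : R) : 0 <= t -> A (x t).
  apply: (averaging_flow_in_convex cA cvA (ltW r0) xc _ _ Dx) => //.
  by rewrite x0.
have Dv (t : R) : 0 < t -> is_derive t 1 v ((t / r) *: (B *m W (u t))).
  move=> t0; rewrite (_ : _ *: _ = derive1 v t).
    by rewrite derive1E; exact/derivableP/dv.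
  apply: block_inj => i; have [_ _ _ ->] := ode t t0 i.
  rewrite linearZ/=; congr (_ *: _); rewrite /bracket_v xw//.
  rewrite (grad_of_is_derive (is_derive_S1r _ _)).
  by rewrite -[_ + _ + block i (_ *: _)]addrA -linearD yv// addrK.
have Du (t : R) : 0 < t -> is_derive t 1 u
    ((t / r) *: (- (grad F (x t) + B *m v t + B *m x t) + W (u t) - u t)).
  move=> t0; rewrite (_ : _ *: _ = derive1 u t).
    by rewrite derive1E; exact/derivableP/du.
  apply: block_inj => i; have [_ _ -> _] := ode t t0 i.
  rewrite linearZ/=; congr (_ *: _); rewrite /bracket_u yv//.
  have dFx := dF _ (Ax _ (ltW t0)).
  rewrite (grad_of_is_derive (fun d => is_derive_S1l ga (v t) d dFx)).
  rewrite -[_ + _ + block i (_ *: _)]addrA -linearD xw//.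
  by rewrite -linearN -linearD -linearB.
pose G := @lagrangian_gap R (n * p) F B xs ys.
have S1s z : S1 a f xs z = F xs by rewrite S1E Bxs !dot0r mulr0 !addr0.
have gapE z w : S1 a f z ys - S1 a f xs w = G z.
  by rewrite S1s S1E /G /lagrangian_gap -/F -/B; ring.
have G0 z : A z -> 0 <= G z.
  by move=> Az; rewrite -(gapE z ys) subr_ge0; have [] := saddle z ys Az.
have [C GC] := gap_decay AW Wvar dF gradF Bsym Bpsd r2 Ax Dx Du Dv Axs Bxs G0.
pose G1 z := F z - F xs + dot ys (B *m z).
have G1G z : G z = G1 z + 2^-1 * dot z (B *m z) by [].
(* [xs] minimises S1(., ys) over [A], and the quadratic term contributes B xs = 0 to the gradient
   there. First-order optimality, with convexity of F, thus bounds the gap without that term. *)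
have G1_ge0 z : A z -> 0 <= G1 z.
  move=> Az.
  have := is_derive_ge0_of_min (is_derive_S1l ga ys (z - xs) (dF _ Axs)).
  rewrite -/F -/B Bxs addr0 dotDl => /(_ _)/wrap[s /andP[s0 s1]|].
    have Azs : A (s *: z + (1 - s) *: xs) by apply: cvxA => //; rewrite !ltW.
    by have [] := saddle _ ys Azs.
  have := gradF _ _ Axs Az.
  have -> : dot (B *m ys) (z - xs) = dot ys (B *m z).
    by rewrite -(dot_bigL ga) -/B mulmxBr Bxs subr0.
  rewrite /G1; lra.
(* Read off at t = 1. The sign is needed for the root in [D] and for C / t^2 <= C / t. *)
have C0 : 0 <= C.
  have := le_trans (G0 _ (Ax _ ler01)) (GC 1 (lexx _)).
  by rewrite expr1n divr1.
have [M M0 BM] := dot_mulmx_sqr_le Bsym Bpsd.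
have xBx (t : R) : 1 <= t -> dot (x t) (B *m x t) <= 2 * C / t ^+ 2.
  move=> t1; have := GC t t1; have := G1_ge0 (x t) (Ax t (le_trans ler01 t1)).
  rewrite -/(G (x t)) G1G -mulrA; lra.
have C_sqr (t : R) : 1 <= t -> C / t ^+ 2 <= C / t.
  move=> t1; have t0 : 0 < t by exact: lt_le_trans t1.
  rewrite ler_wpM2l// lef_pV2 ?posrE ?exprn_gt0//.
  by rewrite expr2 ler_peMl// ltW.
(* From |B x|^2 <= M x^T B x and x^T B x <= 2 C / t^2. *)
pose D := Num.sqrt (M * (2 * C)).
have LD (t : R) : 1 <= t -> enorm (B *m x t) <= D / t.
  move=> t1; have t0 : 0 < t by exact: lt_le_trans t1.
  have tE : t^-1 = Num.sqrt (t ^+ 2)^-1.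
    by rewrite sqrtrV ?sqr_ge0// sqrtr_sqr gtr0_norm.
  rewrite enormE /D tE -sqrtrM ?mulr_ge0// ?(ltW M0)// ler_sqrt; last first.
    by rewrite !mulr_ge0// ?invr_ge0 ?sqr_ge0// ltW.
  apply: le_trans (BM _) _; rewrite -[leRHS]mulrA ler_pM2l//.
  exact: xBx.
(* [G1] differs from F by an affine function and vanishes at [xs], so it inherits the equality case
   of F. *)
have G1cvx z s : A z -> 0 < s < 1 ->
    G1 (s *: z + (1 - s) *: xs) <= s * G1 z ?= iff (z == xs).
  move=> Az s01; have := cvxF z xs s Az Axs s01.
  rewrite /G1 mulmxDr -!scalemxAr Bxs scaler0 addr0 dotZr => -[le eqE].
  split; first lra.
  by rewrite -eqE; apply/eqP/eqP; lra.
split.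
- split=> [t t0|]; first by rewrite gapE; exact/G0/Ax.
  exists C; near=> t; rewrite gapE; apply: GC.
  by near: t; exact: nbhs_pinfty_ge.
- apply: (cvg_of_convex_min (g := G1) cA cvA) => //.
  + move=> z; rewrite inE => Az.
    apply: (@continuousD _ _ _ (fun z => F z - F xs) (fun z => dot ys (B *m z))).
      apply: (@continuousB _ _ _ F (cst (F xs))); last exact: cst_continuous.
      exact/differentiable_continuous/dF.
    apply: (@continuous_comp _ _ _ (mulmx B) (dot ys)).
      exact: cV_linear_continuous.
    exact: continuous_dotr.
  (* At the midpoint of [z] and [xs], [G1] is nonnegative and strictly below G1 z / 2. *)
  + move=> z Az zxs.
    have h2 : 0 < (2^-1 : R) < 1 by rewrite invr_gt0 invf_lt1 ?ltr0n ?ltr1n.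
    have := lt_leif (G1cvx z 2^-1 Az h2); rewrite zxs => lt.
    have := le_lt_trans (G1_ge0 _ (cvxA _ _ 2^-1 Az Axs _)) lt.
    by rewrite pmulr_rgt0 ?invr_gt0//; apply; case/andP: h2 => *; rewrite !ltW.
  + move=> z s Az /andP[s0]; rewrite le_eqVlt => /predU1P[->|s1].
      by rewrite scale1r subrr scale0r addr0 mul1r.
    by have [] := G1cvx z s Az; rewrite ?s0.
  + by near=> t; apply: Ax; near: t; exact: nbhs_pinfty_ge.
  + move=> d d0; near=> t.
    have t1 : 1 <= t by near: t; exact: nbhs_pinfty_ge.
    have t0 : 0 < t by exact: lt_le_trans t1.
    have Cdt : C / d < t by near: t; apply: nbhs_pinfty_gt; exact: num_real.
    apply: (@le_lt_trans _ _ (C / t)); last first.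
      by rewrite ltr_pdivrMr// mulrC -ltr_pdivrMr.
    apply: le_trans (C_sqr t t1); apply: le_trans (GC t t1).
    by rewrite -/(G _) G1G lerDl mulr_ge0// ?invr_ge0.
- split=> [t t0|]; first exact: sqrtr_ge0.
  exists D; near=> t; rewrite expr1; apply: LD.
  by near: t; exact: nbhs_pinfty_ge.
- split=> [t t0|]; first exact: normr_ge0.
  (* F x - F xs is G1 x - ys^T B x: the first term lies between 0 and C / t, the second is
     controlled by the rate of B x. *)
  exists (C + (\sum_k `|ys k 0|) * D); near=> t.
  have t1 : 1 <= t by near: t; exact: nbhs_pinfty_ge.
  have t0 : 0 < t by exact: lt_le_trans t1.
  have S0 : 0 <= \sum_k `|ys k 0| by exact: sumr_ge0.
  have := le_trans (norm_dot_le ys _) (ler_wpM2l S0 (LD t t1)).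
  have := le_trans (GC t t1) (C_sqr t t1); have := G0 _ (Ax _ (ltW t0)).
  have := G1_ge0 _ (Ax _ (ltW t0)); have := Bpsd (x t).
  rewrite -/(G (x t)) G1G /G1 -/F expr1 mulrDl mulrA.
  by rewrite !ler_norml; lra.
Unshelve. all: by end_near. Qed.
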